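(* Let $n\ge 2$, let $J\subseteq[n-1]$ and $J'=J\cup\{n\}$. Let $U$ be the $\Omega_J\times\Omega_{J'}$ matrix whose $(v,u)$ entry is the number of $\vartheta\in\{+,-\}^n$ with $v=\tau_\vartheta u$. Then \[ U M_{J'} = M_J U. \] Consequently, if $u$ is distributed according to $\pi_{J'}$ and $\vartheta$ is chosen uniformly from $\{+,-\}^n$ independently, then $\tau_\vartheta u$ is distributed according to $\pi_J$.
   Context: Type C TASEP. Fix $n\ge 2$. Sites: upper $U_1,\dots,U_n$, lower $L_1,\dots,L_n$ (column $j$ consists of $U_j,L_j$). Counter-clockwise successor: $\mathrm{succ}(U_j)=U_{j-1}$ ($j\ge2$), $\mathrm{succ}(U_1)=L_1$, $\mathrm{succ}(L_j)=L_{j+1}$ ($j<n$), $\mathrm{succ}(L_n)=U_n$; the clockwise successor is the inverse map ($U_j\mapsto U_{j+1}$ for $j<n$, $U_n\mapsto L_n$, $L_j\mapsto L_{j-1}$ for $j>1$, $L_1\mapsto U_1$). A state places particles with positive integer classes on sites, at most one per column. Bell at site $s$: if $s$ holds particle $p$ and $s'=\mathrm{succ}(s)$ is empty, $p$ moves to $s'$; if $s'$ holds a particle of strictly larger class, they swap; otherwise nothing. $\sigma_0$ = bell at $U_1$; $\sigma_n$ = bell at $L_n$; for $0<j<n$, $\sigma_j$ = bells at $L_j$ and $U_{j+1}$. The chain $\Theta$ has transitions $x\to\sigma_jx$, $j=0,\dots,n$, of rate $1$ for $j\in\{0,n\}$ and $2$ for $0<j<n$. For $J\subseteq[n]$: starting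 from one particle of each class $1,\dots,n$, identify classes $j,j+1$ for each $j\in J\setminus\{n\}$, remove class $n$ if $n\in J$, renumber; the resulting counts form the type $\mathbf m_J$, $\Omega_J$ is the set of states of that type, $\Theta_J$ the restriction of $\Theta$ to $\Omega_J$, with unique stationary distribution $\pi_J$. $M_J$ is the $\Omega_J\times\Omega_J$ matrix whose $(x,y)$ entry is the total rate of transitions of $\Theta_J$ from $y$ to $x$. The map $\tau_\vartheta$: for $u\in\Omega_{J'}$ and $\vartheta\in\{+,-\}^n$, build a state $v$ as follows. The designated sites of $v$ are, for each column $j$, $U_j$ if $\vartheta_j=+$ and $L_j$ if $\vartheta_j=-$; initially all are ''not yet occupied''. Process the particles of $u$ in an order of nondecreasing class (order among equal classes is irrelevant): for a particle $p$ at site $s$ of $u$, place $p$ (with its class) at the first not-yet-occupied designated site encountered starting at $s$ itself and moving clockwise; that site becomes occupied. After all particles of $u$ are processed, fill the remaining designated sites with particles of a new class one larger than the largest class in $u$. Then $v=\tau_\vartheta u\in\Omega_J$. *)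

(* Defs.v *)
From mathcomp Require Import all_boot all_order all_algebra.
Set Implicit Arguments. Unset Strict Implicit. Unset Printing Implicit Defensive.
Import Order.TTheory GRing.Theory Num.Theory.

(* Type C TASEP.  Columns are indexed 0-based by 'I_n: column j : 'I_n is the
   paper's column j+1.  A site is a pair (j, b) with b = true for the upper
   site U_{j+1} and b = false for the lower site L_{j+1}.  A (generalized)
   configuration assigns to each site either nothing or a particle class
   (classes are the values of 'I_n.+1; the states of Omega_J only use classes
   1..n). *)

Section TypeC.
Variable n : nat.

Definition site : finType := ('I_n * bool)%type.
Definition state : finType := {ffun site -> option 'I_n.+1}.

(* counter-clockwise successor *)
Definition succ (s : site) : site :=
  let j := val s.1 in
  if s.2 then (if 0 < j then (insubd s.1 j.-1, true) else (s.1, false))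
  else (if j.+1 < n then (insubd s.1 j.+1, false) else (s.1, true)).

(* clockwise successor (inverse of succ) *)
Definition csucc (s : site) : site :=
  let j := val s.1 in
  if s.2 then (if j.+1 < n then (insubd s.1 j.+1, true) else (s.1, false))
  else (if 0 < j then (insubd s.1 j.-1, false) else (s.1, true)).

Definition bell (s : site) (x : state) : state :=
  let s' := succ s in
  match x s with
  | None => x
  | Some p =>
    match x s' with
    | None => [ffun t => if t == s then None else if t == s' then Some p else x t]
    | Some q =>
      if (val p < val q)%N then
        [ffun t => if t == s then Some q else if t == s' then Some p else x t]
      else x
    end
  end.

(* bell at site (column k+1 in the paper, i.e. 0-based column k, side b) *)
Definition bell_at (k : nat) (b : bool) (x : state) : state :=
  match insub k with Some j => bell (j, b) x | None => x end.

(* sigma_0 = bell at U_1; sigma_n = bell at L_n;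
   sigma_j = bells at L_j and U_{j+1} for 0 < j < n *)
Definition sigma (j : nat) (x : state) : state :=
  if j == 0 then bell_at 0 true x
  else if j == n then bell_at n.-1 false x
  else bell_at j.-1 false (bell_at j true x).

Definition rate (j : nat) : nat := if (j == 0) || (j == n) then 1 else 2.

(* class of original particle i (1 <= i <= n) after identifying j, j+1
   for j in J, j < n, and renumbering *)
Definition cls (J : pred nat) (i : nat) : nat := i - count J (iota 1 i.-1).

(* number of particles of class c in the type m_J; if n \in J the (merged)
   class containing the original class n is removed *)
Definition mJ (J : pred nat) (c : nat) : nat :=
  count (fun i => (cls J i == c) && ~~ (J n && (cls J i == cls J n))) (iota 1 n).

Definition count_class (x : state) (c : 'I_n.+1) : nat := #|[pred s | x s == Some c]|.

Definition Omega (J : pred nat) : {set state} :=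
  [set x : state | [forall j : 'I_n, ~~ (x (j, true) && x (j, false))]
                   && [forall c : 'I_n.+1, count_class x c == mJ J c]].

Definition M (J : pred nat) (x y : state) : nat :=
  if (x \in Omega J) && (y \in Omega J) then
    \sum_(j < n.+1) rate j * (sigma j y == x)
  else 0.

(* theta j = true means '+' (designated site U), false means '-' (L) *)
Definition designated (theta : {ffun 'I_n -> bool}) (s : site) : bool :=
  s.2 == theta s.1.

Definition place (theta : {ffun 'I_n -> bool}) (v : state) (s : site)
    (c : 'I_n.+1) : state :=
  match [seq t <- [seq iter k csucc s | k <- iota 0 (2 * n)]
         | designated theta t && (v t == None)] with
  | t :: _ => [ffun r => if r == t then Some c else v r]
  | [::] => v
  end.

Definition tau (theta : {ffun 'I_n -> bool}) (u : state) : state :=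
  let order := flatten [seq [seq (s, c) | s <- enum site & u s == Some c]
                       | c <- enum 'I_n.+1] in
  let v := foldl (fun v p => place theta v p.1 p.2) [ffun => None] order in
  let maxc := \max_(s : site) (if u s is Some c then val c else 0) in
  let newc : 'I_n.+1 := inord maxc.+1 in
  [ffun t => if designated theta t && (v t == None) then Some newc else v t].

Definition Ucnt (v u : state) : nat :=
  #|[set theta : {ffun 'I_n -> bool} | tau theta u == v]|.

Definition extJ (J : pred nat) : pred nat := fun j => J j || (j == n).

Definition is_stationary (R : realFieldType) (J : pred nat) (p : state -> R) : Prop :=
  [/\ forall x, (0 <= p x)%R,
      forall x, x \notin Omega J -> p x = 0,
      (\sum_(x : state) p x = 1)%R &
      forall x, x \in Omega J ->
        \sum_(y in Omega J) (M J x y)%:R * p y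
        = (\sum_(y in Omega J) (M J y x)%:R) * p x]%R.

End TypeC.

(* Main.v *)
Require Import Defs.
From mathcomp Require Import all_boot all_order all_algebra.
From mathcomp Require Import perm zify ring.
Import Order.TTheory GRing.Theory Num.Theory.

(* Sites form a ring, and for a fixed class c the sites of tau_theta u holding
   a class at most c are the servers used by a queue travelling clockwise, whose
   customers are the particles of u of class at most c.  Such a queue is
   characterized by a local recursion with a unique solution, and a bell acts on
   each class threshold separately, exchanging two adjacent sites; hence the
   effect of a bell on tau_theta u can be read off by changing the queue length
   on a single edge.

   Regard theta as a one-species configuration.  If sigma_j moves theta to
   theta', then tau_theta (sigma_j u) = tau_theta u,
   sigma_j (tau_theta u) = tau_theta' (sigma_j u) and sigma_j fixes tau_theta' u;
   if sigma_j moves theta neither forwards nor backwards, then sigma_j commutes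
   with tau_theta.  Summing over theta, the two sides of the intertwining
   relation differ at j by the number of theta with tau_theta u = v that
   sigma_j moves, minus the number of those that it moves backwards.  For every
   theta the total rates of the two kinds of moves agree (the uniform
   distribution is stationary for theta), so the differences cancel after
   summation over j. *)

(** * The ring of sites and clockwise queues on it *)

Section Ring.
Set Implicit Arguments. Unset Strict Implicit. Unset Printing Implicit Defensive.
Variable n : nat.
Implicit Types (s t x : site n) (D O : pred (site n)) (P q : site n -> nat).

Lemma val_insubd_ord (j : 'I_n) k : (k < n)%N -> nat_of_ord (insubd j k) = k.
Proof. by move=> h; rewrite -[LHS]/(val _) val_insubd h. Qed.

Lemma csuccK : cancel (@csucc n) (@succ n).
Proof.
case=> -[j Hj] []; rewrite /csucc /succ /=.
- have [h|/negbTE h] := boolP (j.+1 < n)%N; last by rewrite /= h.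
  by rewrite /= val_insubd_ord //=; congr pair; apply/val_inj; rewrite /= val_insubd_ord.
- have [h|/negbTE h] := boolP (0 < j)%N; last by rewrite /= h.
  rewrite /= val_insubd_ord /=; last by lia.
  by rewrite prednK // Hj; congr pair; apply/val_inj; rewrite /= val_insubd_ord.
Qed.

Lemma succK : cancel (@succ n) (@csucc n).
Proof.
case=> -[j Hj] []; rewrite /csucc /succ /=.
- have [h|/negbTE h] := boolP (0 < j)%N; last by rewrite /= h.
  rewrite /= val_insubd_ord /=; last by lia.
  by rewrite prednK // Hj; congr pair; apply/val_inj; rewrite /= val_insubd_ord.
- have [h|/negbTE h] := boolP (j.+1 < n)%N; last by rewrite /= h.
  by rewrite /= val_insubd_ord //=; congr pair; apply/val_inj; rewrite /= val_insubd_ord.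
Qed.

Lemma succ_neq s : (succ s == s) = false.
Proof.
apply/eqP; case: s => -[j Hj] []; rewrite /succ /=; case: ifP => h // [] /(congr1 val) /=;
  rewrite val_insubd_ord; lia.
Qed.

(** Numbers the sites clockwise from [U_1], so that [csucc] becomes addition of 1 modulo [2 * n]. *)
Definition ring_pos s : nat := if s.2 then val s.1 else (2 * n).-1 - val s.1.

Lemma ring_pos_lt s : (ring_pos s < 2 * n)%N.
Proof. by case: s => -[j Hj] []; rewrite /ring_pos /=; lia. Qed.

Lemma ring_pos_inj : injective ring_pos.
Proof.
move=> [[i Hi] a] [[j Hj] b]; rewrite /ring_pos /=.
by case: a; case: b => /= h; try (exfalso; lia); congr pair; apply/val_inj => /=; lia.
Qed.

Lemma ring_pos_csucc s : ring_pos (csucc s) = ((ring_pos s).+1 %% (2 * n))%N.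
Proof.
case: s => -[j Hj] []; rewrite /csucc /ring_pos /=.
- case: (boolP (j.+1 < n)%N) => h /=; first by rewrite val_insubd_ord // modn_small; lia.
  by rewrite modn_small; lia.
- case: (boolP (0 < j)%N) => h /=; first by rewrite val_insubd_ord ?modn_small; lia.
  have -> : ((2 * n).-1 - j).+1 = (2 * n)%N by lia.
  by rewrite modnn; lia.
Qed.

Lemma ring_pos_iter k s :
  ring_pos (iter k (@csucc n) s) = ((ring_pos s + k) %% (2 * n))%N.
Proof.
elim: k => [|k IH] /=; first by rewrite addn0 modn_small // ring_pos_lt.
by rewrite ring_pos_csucc IH -addn1 modnDml addn1 addnS.
Qed.

Lemma csucc_reach s t : exists2 k, (k < 2 * n)%N & iter k (@csucc n) s = t.
Proof.
have hs := ring_pos_lt s; have ht := ring_pos_lt t.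
exists ((ring_pos t + (2 * n - ring_pos s)) %% (2 * n))%N; first by rewrite ltn_mod; lia.
apply: ring_pos_inj; rewrite ring_pos_iter modnDmr.
have -> : (ring_pos s + (ring_pos t + (2 * n - ring_pos s)) = ring_pos t + 2 * n)%N by lia.
by rewrite modnDr modn_small.
Qed.

(* Lindley recursion of a queue travelling clockwise: [P] counts the arrivals,
   [D] marks the servers, [O] the servers in use, and [q x] is the number of
   customers leaving site [x]. *)
Definition queue D P q O := forall x,
  (q x + O x = q (succ x) + P x)%N /\ O x = D x && (0 < q (succ x) + P x)%N.

(* The distance between two solutions is nonincreasing along the ring, hence
   constant, which forbids a server used in only one of them. *)
Lemma queue_uniq D P q1 q2 O1 O2 :
  queue D P q1 O1 -> queue D P q2 O2 -> O1 =1 O2.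
Proof.
move=> h1 h2.
pose d x := ((q1 x - q2 x) + (q2 x - q1 x))%N.
have dle x : (d x <= d (succ x) ?= iff (d x == d (succ x)))%N.
  split=> //; rewrite /d; have [e1 o1] := h1 x; have [e2 o2] := h2 x.
  by move: e1 e2; rewrite o1 o2; case: (D x) => /=; lia.
have /leqif_sum := fun x (_ : xpredT x) => dle x.
have -> : (\sum_(x | xpredT x) d (succ x) = \sum_(x | xpredT x) d x)%N.
  by rewrite [RHS](reindex_inj (can_inj succK)).
case=> _; rewrite eqxx => /esym/forallP deq x.
have /eqP := deq x; rewrite /d.
have [e1 o1] := h1 x; have [e2 o2] := h2 x.
move: e1 e2; rewrite o1 o2; case: (D x) => //=; lia.
Qed.

(** The effect of a bell at [s] on a one-species configuration [A]. *)
Definition hop s (A : pred (site n)) : pred (site n) := fun x =>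
  if A s && ~~ A (succ s) then (x != s) && ((x == succ s) || A x) else A x.

Definition update_queue s q (k : nat) x := if x == succ s then k else q x.

(** Customers travel clockwise, so the edge from [succ s] to [s] carries [q (succ s)]. A change at
    these two sites alone is absorbed by a new length [k] on that edge, and the recursion has to be
    rechecked only at its two ends. *)
Lemma queue_update s q D D' (P P' O O' : pred (site n)) (k : nat) :
  queue D P q O ->
  (forall x, x != s -> x != succ s -> [/\ D' x = D x, P' x = P x & O' x = O x]) ->
  (k + O' (succ s) = q (succ (succ s)) + P' (succ s))%N ->
  (q s + O' s = k + P' s)%N ->
  O' (succ s) = D' (succ s) && (0 < q (succ (succ s)) + P' (succ s))%N ->
  O' s = D' s && (0 < k + P' s)%N ->
  queue D' P' (update_queue s q k) O'.
Proof.
move=> h hx e1 e2 o1 o2 x; rewrite /update_queue (inj_eq (can_inj succK)).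
have [->|xs] := eqVneq x s; first by rewrite eq_sym succ_neq.
have [->|xs'] := eqVneq x (succ s); first by [].
by have [-> -> ->] := hx x xs xs'.
Qed.

Lemma hop_off s A x : x != s -> x != succ s -> hop s A x = A x.
Proof. by move=> /negbTE xs /negbTE xs'; rewrite /hop xs xs' /=; case: ifP. Qed.

Lemma hop_src s A : hop s A s = A s && A (succ s).
Proof. by rewrite /hop eqxx; case: (A s); case: (A (succ s)). Qed.

Lemma hop_dst s A : hop s A (succ s) = A s || A (succ s).
Proof. by rewrite /hop succ_neq eqxx; case: (A s); case: (A (succ s)). Qed.

(** [O] hops only when no customer is present at [succ s] and one arrives at [s]; that arrival hops
    too and takes its service along. Otherwise a hopping arrival joins a nonempty queue, and both
    servers stay in use. *)
Lemma queue_hop_both s D (P O : pred (site n)) q :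
  D s -> D (succ s) -> queue D P q O ->
  exists q', queue D (hop s P) q' (hop s O).
Proof.
move=> Ds Ds' h; have [e1 o1] := h s; have [e2 o2] := h (succ s).
exists (update_queue s q (q (succ (succ s)) + hop s P (succ s) - hop s O (succ s))).
move: e1 e2 o1 o2; rewrite Ds Ds' /=.
move=> e1 e2 o1 o2; apply: (queue_update h); first by move=> x xs xs'; rewrite ?hop_off.
all: rewrite ?hop_src ?hop_dst ?Ds ?Ds' /=; move: e1 e2 o1 o2;
  case: (O s); case: (O (succ s)); case: (P s); case: (P (succ s)) => /=; lia.
Qed.

(** Without a server at [succ s], a customer arriving there passes on to [s], so moving an arrival
    back by one site changes no service. *)
Lemma queue_hop_undesignated s D (P O : pred (site n)) q :
  ~~ D (succ s) -> queue D P q O ->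
  exists q', queue D (hop s P) q' O.
Proof.
move=> /negbTE Ds' h; have [e1 o1] := h s; have [e2 o2] := h (succ s).
exists (update_queue s q (q (succ (succ s)) + hop s P (succ s))).
move: e1 e2 o1 o2; rewrite Ds' /=.
move=> e1 e2 o1 o2; apply: (queue_update h); first by move=> x xs xs'; rewrite ?hop_off.
all: rewrite ?hop_src ?hop_dst ?Ds ?Ds' /=; move: e1 e2 o1 o2;
  case: (D s); case: (O s); case: (O (succ s)); case: (P s); case: (P (succ s)) => /=; lia.
Qed.

(** The server at [s] is used if and only if a customer waits before [succ s] or arrives at one of
    the two sites. After the hops the server at [succ s] is used under the same condition. *)
Lemma queue_hop_server s D (P O : pred (site n)) q :
  D s -> ~~ D (succ s) -> queue D P q O ->
  exists q', queue (hop s D) (hop s P) q' (hop s O).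
Proof.
move=> Ds /negbTE Ds' h; have [e1 o1] := h s; have [e2 o2] := h (succ s).
exists (update_queue s q (q (succ (succ s)) + hop s P (succ s) - hop s O (succ s))).
move: e1 e2 o1 o2; rewrite Ds Ds' /=.
move=> e1 e2 o1 o2; apply: (queue_update h); first by move=> x xs xs'; rewrite ?hop_off.
all: rewrite ?hop_src ?hop_dst ?Ds ?Ds' /=; move: e1 e2 o1 o2;
  case: (O s); case: (O (succ s)); case: (P s); case: (P (succ s)) => /=; lia.
Qed.

Lemma queue_ext D D' P P' q O O' :
  D =1 D' -> P =1 P' -> O =1 O' -> queue D P q O -> queue D' P' q O'.
Proof. by move=> hD hP hO h x; rewrite -hD -hP -hO; apply: h. Qed.

Lemma eq_hop s A B : A =1 B -> hop s A =1 hop s B.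
Proof. by move=> h x; rewrite /hop !h. Qed.

(** * Class thresholds and the characterization of tau *)

Implicit Types (u v : state n) (c : 'I_n.+1).

Definition lev c u : pred (site n) := fun x => if u x is Some p then (p <= c)%N else false.

Lemma lev_max u x : lev ord_max u x = isSome (u x).
Proof. by rewrite /lev; case: (u x) => //= p; apply: leq_ord. Qed.

Lemma lev_inj u v : (forall c, lev c u =1 lev c v) -> u = v.
Proof.
move=> h; apply/ffunP => x.
have hm := h ord_max x; rewrite !lev_max in hm.
case Eu: (u x) hm => [p|]; case Ev: (v x) => [p'|] //= _.
congr Some; apply/val_inj/eqP; rewrite eqn_leq.
have := h p' x; have := h p x; rewrite /lev Eu Ev !leqnn => hp hp'.
by rewrite hp' -hp.
Qed.

(** Empty sites behave like a class above all others. A swap across the threshold is a hop; a swap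
    of two classes on the same side of it is invisible. *)
Lemma lev_bell c s u : lev c (bell s u) =1 hop s (lev c u).
Proof.
move=> x; rewrite /bell.
case Es: (u s) => [p|]; last first.
  by have ls : lev c u s = false; [rewrite /lev Es|rewrite /hop ls].
case Es': (u (succ s)) => [p'|]; last first.
  have [->|xs] := eqVneq x s.
    by rewrite hop_src /lev ffunE eqxx Es Es' andbF.
  have [->|xs'] := eqVneq x (succ s).
    by rewrite hop_dst /lev ffunE succ_neq eqxx Es Es' orbF.
  by rewrite hop_off // /lev ffunE (negbTE xs) (negbTE xs').
case: ltnP => pp'; last first.
  have lss' : lev c u s -> lev c u (succ s) by rewrite /lev Es Es'; apply: leq_trans.
  by rewrite /hop; case: ifP => // /andP[/lss' ->].
have [->|xs] := eqVneq x s.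
  by rewrite hop_src /lev ffunE eqxx Es Es' /=; move: pp' => /=; lia.
have [->|xs'] := eqVneq x (succ s).
  by rewrite hop_dst /lev ffunE succ_neq eqxx Es Es' /=; move: pp' => /=; lia.
by rewrite hop_off // /lev ffunE (negbTE xs) (negbTE xs').
Qed.

(* [v] is obtained from [u] by the rule defining tau, with designated sites [D]
   and with new class [K]; [D] need not have one site in each column. *)
Definition tau_rel D (K : nat) u v := forall c,
  if (c < K)%N then exists q, queue D (lev c u) q (lev c v) else lev c v =1 D.

(** Identities between values of [tau] thus follow from the local recursion, without following the
    placing process. *)
Lemma tau_rel_uniq D K u v w : tau_rel D K u v -> tau_rel D K u w -> v = w.
Proof.
move=> hv hw; apply: lev_inj => c; have := hv c; have := hw c.
by case: ifP => _ => [[q1 h1] [q2 h2]|h1 h2]; [apply: queue_uniq h2 h1|move=> x; rewrite h1 h2].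
Qed.

Lemma tau_rel_ext D D' K u v : D =1 D' -> tau_rel D K u v -> tau_rel D' K u v.
Proof.
move=> hD h c; have := h c; case: ifP => _; last by move=> h' x; rewrite h' hD.
by case=> q hq; exists q; apply: queue_ext hq.
Qed.

Lemma tau_rel_free D K u v s : tau_rel D K u v -> ~~ D s -> bell s v = v.
Proof.
move=> h /negbTE Ds; have : lev ord_max v s = false.
  by have := h ord_max; case: ifP => _ => [[q /(_ s)[_ ->]]|->]; rewrite Ds.
by rewrite lev_max /bell; case: (v s).
Qed.

Lemma tau_rel_both D K u v s : D s -> D (succ s) ->
  tau_rel D K u v -> tau_rel D K (bell s u) (bell s v).
Proof.
move=> Ds Ds' h c; have := h c; case: ifP => _ => [[q hq]|hv].
  have [q' hq'] := queue_hop_both Ds Ds' hq; exists q'.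
  by apply: queue_ext hq' => // x; rewrite lev_bell.
move=> x; rewrite lev_bell (eq_hop _ hv).
have [->|xs] := eqVneq x s; first by rewrite hop_src Ds Ds'.
by have [->|xs'] := eqVneq x (succ s); [rewrite hop_dst Ds Ds'|rewrite hop_off].
Qed.

Lemma tau_rel_undesignated D K u v s : ~~ D (succ s) ->
  tau_rel D K u v -> tau_rel D K (bell s u) v.
Proof.
move=> Ds' h c; have := h c; case: ifP => _ // [q hq].
have [q' hq'] := queue_hop_undesignated Ds' hq; exists q'.
by apply: queue_ext hq' => // x; rewrite lev_bell.
Qed.

Lemma tau_rel_server D K u v s : D s -> ~~ D (succ s) ->
  tau_rel D K u v -> tau_rel (hop s D) K (bell s u) (bell s v).
Proof.
move=> Ds Ds' h c; have := h c; case: ifP => _ => [[q hq]|hv].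
  have [q' hq'] := queue_hop_server Ds Ds' hq; exists q'.
  by apply: queue_ext hq' => // x; rewrite lev_bell.
by move=> x; rewrite lev_bell (eq_hop _ hv).
Qed.

End Ring.

(** * The operators sigma and their action on theta *)

Section Sigma.
Set Implicit Arguments. Unset Strict Implicit. Unset Printing Implicit Defensive.
Variable n : nat.
Implicit Types (theta : {ffun 'I_n -> bool}) (u v x : state n).

Lemma sigma0E (k : 'I_n) x : k = 0%N :> nat -> sigma 0 x = bell (k, true) x.
Proof.
move=> k0; rewrite /sigma /= /bell_at; case: insubP => [i _ ei|]; last by rewrite -k0 ltn_ord.
by congr (bell (_, _) x); apply/val_inj; rewrite /= k0.
Qed.

Lemma sigmanE (k : 'I_n) x : k.+1 = n -> sigma n x = bell (k, false) x.
Proof.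
move=> kn; rewrite /sigma eqxx ifF; last by lia.
rewrite /bell_at; case: insubP => [i _ ei|]; last by lia.
by congr (bell (_, _) x); apply/val_inj; rewrite /= ei; lia.
Qed.

Lemma sigmaE (k l : 'I_n) x : k.+1 = l ->
  sigma l x = bell (k, false) (bell (l, true) x).
Proof.
move=> kl; have ln := ltn_ord l; rewrite /sigma !ifF; [|lia..].
rewrite /bell_at; case: insubP => [i _ ei|]; last by lia.
case: insubP => [i' _ ei'|]; last by lia.
by congr (bell (_, _) (bell (_, _) x)); apply/val_inj; rewrite //= ei; lia.
Qed.

Lemma succU0 (k : 'I_n) : k = 0%N :> nat -> succ (k, true) = (k, false).
Proof. by rewrite /succ /= => ->. Qed.

Lemma succLn (k : 'I_n) : k.+1 = n -> succ (k, false) = (k, true).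
Proof. by rewrite /succ /= => ->; rewrite ltnn. Qed.

Lemma succU (k l : 'I_n) : k.+1 = l -> succ (l, true) = (k, true).
Proof.
move=> kl; rewrite /succ /= -kl /=; congr pair; apply/val_inj.
by rewrite /= val_insubd_ord.
Qed.

Lemma succL (k l : 'I_n) : k.+1 = l -> succ (k, false) = (l, false).
Proof.
move=> kl; rewrite /succ /= kl ltn_ord; congr pair; apply/val_inj.
by rewrite /= val_insubd_ord.
Qed.

(** Supplies the columns touched by [sigma j] as elements of ['I_n]. With 0-based columns, an
    interior [sigma l] rings at the lower site of [k = l - 1] and at the upper site of [l]. *)
Lemma sigma_ind (Q : nat -> Prop) : (0 < n)%N ->
  (forall k : 'I_n, k = 0%N :> nat -> Q 0%N) ->
  (forall k : 'I_n, k.+1 = n -> Q n) ->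
  (forall k l : 'I_n, k.+1 = l -> Q l) ->
  forall j, (j <= n)%N -> Q j.
Proof.
move=> n0 h0 hn hm [|j] hj; first exact: (h0 (Ordinal n0)).
have [jn|jn] := ltnP j.+1 n; last first.
  have -> : j.+1 = n by lia.
  by apply: (hn (Ordinal hj)) => /=; lia.
exact: (hm (Ordinal hj) (Ordinal jn)).
Qed.

(* With + read as "particle on the upper row", [movable j theta] says that
   sigma_j moves the particles of the one-species configuration [theta]. *)
Definition movable (j : nat) theta :=
  [forall i : 'I_n, ((i == j :> nat) ==> theta i) && ((i.+1 == j) ==> ~~ theta i)].

(** The result of [sigma j] on a movable [theta]. As [flip j] is an involution,
    [movable j (flip j theta)] says that [theta] itself results from a move, that is, can be moved
    backwards. *)
Definition flip (j : nat) theta : {ffun 'I_n -> bool} :=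
  [ffun i => theta i (+) ((i == j :> nat) || (i.+1 == j))].

Lemma flipK j : involutive (flip j).
Proof. by move=> theta; apply/ffunP => i; rewrite !ffunE -addbA addbb addbF. Qed.

Lemma movable0 (k : 'I_n) theta : k = 0%N :> nat -> movable 0 theta = theta k.
Proof.
move=> k0; apply/forallP/idP => [/(_ k)|h i]; first by rewrite k0 andbT.
by rewrite andbT; apply/implyP => /eqP i0; rewrite (_ : i = k) //; apply/val_inj; rewrite /= i0.
Qed.

Lemma movablen (k : 'I_n) theta : k.+1 = n -> movable n theta = ~~ theta k.
Proof.
move=> kn; apply/forallP/idP => [/(_ k)|h i].
  by rewrite kn eqxx => /andP[].
apply/andP; split; first by have := ltn_ord i; lia.
by apply/implyP => /eqP i0; rewrite (_ : i = k) //; apply/val_inj => /=; lia.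
Qed.

Lemma movable_mid (k l : 'I_n) theta : k.+1 = l ->
  movable l theta = theta l && ~~ theta k.
Proof.
move=> kl; apply/forallP/idP => [h|/andP[hl hk] i].
  have := h l; have := h k; rewrite eqxx kl eqxx => /= /andP[_ hk] /andP[hl _].
  by rewrite hl.
apply/andP; split; apply/implyP => /eqP i0.
  by rewrite (_ : i = l) //; apply/val_inj.
by rewrite (_ : i = k) //; apply/val_inj => /=; lia.
Qed.

(** At an interior [j] the two bells are treated one after the other. In the movable case the
    designated sites after the first bell are two in column [k] and none in column [l], which is why
    [tau_rel] allows an arbitrary [D]. *)
Lemma sigma_tau_rel theta (j K : nat) u v : (0 < n)%N -> (j <= n)%N ->
  tau_rel (designated theta) K u v ->
  [/\ movable j theta -> tau_rel (designated theta) K (sigma j u) v /\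
        tau_rel (designated (flip j theta)) K (sigma j u) (sigma j v),
      movable j (flip j theta) -> sigma j v = v &
      ~~ movable j theta -> ~~ movable j (flip j theta) ->
        tau_rel (designated theta) K (sigma j u) (sigma j v)].
Proof.
move=> n0 jn h; move: j jn; apply: sigma_ind => // [k k0|k kn|k l kl].
- rewrite !(movable0 _ k0) !(sigma0E _ k0) ffunE k0 eqxx /= addbT negbK.
  have sk := succU0 k0.
  split=> [hk|hk|/negbTE->] //; last first.
    by apply: tau_rel_free h _; rewrite /designated /= eq_sym eqb_id.
  have Ds : designated theta (k, true) by rewrite /designated /= hk.
  have Ds' : ~~ designated theta (succ (k, true)) by rewrite sk /designated /= hk.
  split; first exact: tau_rel_undesignated.
  apply: tau_rel_ext (tau_rel_server Ds Ds' h) => -[i b].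
  have [->|] := eqVneq (i, b) (k, true).
    by rewrite hop_src (negbTE Ds') andbF /designated /= ffunE k0 /= hk.
  have [->|] := eqVneq (i, b) (succ (k, true)).
    by rewrite hop_dst Ds sk /designated /= ffunE k0 /= hk.
  move=> h1 h2; rewrite hop_off // /designated /= ffunE.
  move: h1 h2; rewrite sk !xpair_eqE -!val_eqE /= k0.
  by case: b; case: (theta i); case: (nat_of_ord i).
- rewrite !(movablen _ kn) !(sigmanE _ kn) ffunE kn eqxx orbT /= addbT !negbK.
  have sk := succLn kn.
  split=> [hk|hk|->] //; last first.
    by apply: tau_rel_free h _; rewrite /designated /= hk.
  have Ds : designated theta (k, false) by rewrite /designated /= (negbTE hk).
  have Ds' : ~~ designated theta (succ (k, false)) by rewrite sk /designated /= (negbTE hk).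
  split; first exact: tau_rel_undesignated.
  apply: tau_rel_ext (tau_rel_server Ds Ds' h) => -[i b].
  have [->|] := eqVneq (i, b) (k, false).
    by rewrite hop_src (negbTE Ds') andbF /designated /= ffunE kn eqxx orbT /= (negbTE hk).
  have [->|] := eqVneq (i, b) (succ (k, false)).
    by rewrite hop_dst Ds sk /designated /= ffunE kn eqxx orbT /= (negbTE hk).
  move=> h1 h2; rewrite hop_off // /designated /= ffunE.
  move: h1 h2; rewrite sk !xpair_eqE -!val_eqE /= => h1 h2.
  have hi := ltn_ord i; rewrite (_ : (i == n :> nat) = false) /=; last by lia.
  have -> : (i.+1 == n) = (i == k :> nat) by lia.
  by move: h1 h2; case: b; case: (theta i); case: (nat_of_ord i == k).
have su := succU kl; have sl := succL kl.
have lk : (l == k :> nat) = false by lia.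
have kl' : (k == l :> nat) = false by lia.
rewrite !(movable_mid _ kl) !(sigmaE _ kl) !ffunE kl kl' eqxx orbT /= !addbT negbK.
split=> [/andP[hl /negbTE hk]|/andP[/negbTE hl hk]|].
- have D1 : designated theta (l, true) by rewrite /designated /= hl.
  have D1' : ~~ designated theta (succ (l, true)) by rewrite su /designated /= hk.
  have D2 : designated theta (k, false) by rewrite /designated /= hk.
  have D2' : ~~ designated theta (succ (k, false)) by rewrite sl /designated /= hl.
  split; first by do 2!apply: tau_rel_undesignated => //.
  have hop1 b : hop (l, true) (designated theta) (b, false) = designated theta (b, false).
    by rewrite hop_off ?su ?xpair_eqE ?andbF.
  have := tau_rel_server D1 D1' h => /tau_rel_server.
  move=> /(_ (k, false)); rewrite sl !hop1 -sl => /(_ D2 D2').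
  apply: tau_rel_ext => -[i []].
    rewrite hop_off ?sl ?xpair_eqE ?andbF //.
    have [->|il] := eqVneq i l.
      by rewrite hop_src (negbTE D1') andbF /designated /= ffunE eqxx hl.
    have [->|ik] := eqVneq i k.
      by rewrite -{1}su hop_dst D1 /designated /= ffunE kl eqxx orbT hk.
    rewrite hop_off ?su ?xpair_eqE ?andbT // /designated /= ffunE.
    rewrite -kl eqSS -!val_eqE /= in il ik *.
    by rewrite kl (negbTE il) (negbTE ik) addbF.
  have [->|ik] := eqVneq i k.
    rewrite hop_src sl !hop1 -sl (negbTE D2') andbF /designated /= ffunE kl eqxx orbT hk.
    by [].
  have [->|il] := eqVneq i l.
    by rewrite -{1}sl hop_dst hop1 D2 /designated /= ffunE eqxx hl.
  rewrite hop_off ?sl ?xpair_eqE ?andbT // hop1 /designated /= ffunE.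
  rewrite -kl eqSS -!val_eqE /= in il ik *.
  by rewrite kl (negbTE il) (negbTE ik) addbF.
- rewrite !(tau_rel_free h) // /designated /= ?hl ?hk //.
rewrite !negb_and !negbK => h1 h2.
have {h1 h2} : theta l = theta k by move: h1 h2; case: (theta l); case: (theta k).
(* Both designated sites lie on one row: the bell on that row acts between two servers, and the
   other bell acts between two undesignated sites. *)
case hk: (theta k) => hl.
- have h' : tau_rel (designated theta) K (bell (l, true) u) (bell (l, true) v).
    by apply: tau_rel_both; rewrite // ?su /designated /= ?hl ?hk.
  rewrite (tau_rel_free h'); last by rewrite /designated /= hk.
  by apply: tau_rel_undesignated; rewrite // sl /designated /= hl.
- rewrite (tau_rel_free h); last by rewrite /designated /= hl.
  apply: tau_rel_both; rewrite ?sl /designated /= ?hl ?hk //.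
  by apply: tau_rel_undesignated; rewrite // su /designated /= hk.
Qed.

(** At an interior [j] the difference of the two indicators is the increment of [theta] between
    neighbouring columns. With rate 2 these telescope to twice (last minus first); the ends, with
    rate 1, contribute (2 first - 1) and (1 - 2 last). *)
Lemma movable_balance theta : (0 < n)%N ->
  (\sum_(j < n.+1) rate n j * movable j theta
   = \sum_(j < n.+1) rate n j * movable j (flip j theta))%N.
Proof.
move=> n0.
(* Extends [theta] to all naturals, so that the telescoping can be indexed by them; the default
   value is never reached. *)
pose t k := if insub k is Some i then theta i else false.
have tE (i : 'I_n) : theta i = t i by rewrite /t valK.
have step (k l : 'I_n) : k.+1 = l ->
    (movable l theta + t k = movable l (flip l theta) + t l)%N.
  move=> kl; rewrite !(movable_mid _ kl) !ffunE -!tE eqxx kl eqxx orbT /= !addbT.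
  by case: (theta k); case: (theta l).
have telescope p : (p < n)%N ->
    (\sum_(i < p) movable i.+1 theta + t 0
     = \sum_(i < p) movable i.+1 (flip i.+1 theta) + t p)%N.
  elim: p => [|p IH] hp; first by rewrite !big_ord0.
  rewrite !big_ord_recr /=; have /= := step (Ordinal (ltnW hp)) (Ordinal hp) erefl.
  by rewrite addnAC (IH (ltnW hp)) -!addnA => <-; rewrite (addnC (nat_of_bool (t p))).
pose k0 : 'I_n := Ordinal n0; have nn : (n.-1 < n)%N by lia.
pose kn : 'I_n := Ordinal nn.
have hk0 : k0 = 0%N :> nat by []; have hkn : kn.+1 = n by rewrite /= prednK.
have split_sum (F : nat -> nat) : (\sum_(j < n.+1) rate n j * F j
    = F 0 + 2 * (\sum_(i < n.-1) F i.+1) + F n)%N.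
  have ends m (G : nat -> nat) :
      (\sum_(j < m.+2) G j = G 0 + \sum_(i < m) G i.+1 + G m.+1)%N.
    by rewrite big_ord_recl big_ord_recr addnA.
  have := ends n.-1 (fun j => rate n j * F j)%N; rewrite prednK // => ->.
  rewrite /rate /= eqxx orbT !mul1n; congr (_ + _ + _)%N.
  rewrite big_distrr; apply: eq_bigr => i _ /=.
  by rewrite ifF // ?add1n; have := ltn_ord i; lia.
rewrite !(split_sum (fun j => nat_of_bool (movable j _))).
rewrite (split_sum (fun j => nat_of_bool (movable j (flip j theta)))).
rewrite !(movable0 _ hk0) !(movablen _ hkn) !ffunE hk0 hkn !eqxx orbT /= !addbT !tE /=.
move: (telescope _ nn); move: (\sum_(i < _) _) (\sum_(i < _) _) => a b.
by case: (t 0); case: (t n.-1) => /=; lia.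
Qed.

End Sigma.

(** * The placing process solves the queue recursion *)

Section Process.
Set Implicit Arguments. Unset Strict Implicit. Unset Printing Implicit Defensive.
Variable n : nat.
Implicit Types (theta : {ffun 'I_n -> bool}) (u v : state n) (s t x : site n).
Implicit Types (c : 'I_n.+1) (p : site n * 'I_n.+1) (l : seq (site n * 'I_n.+1)).

(* The new customer waits on every edge between its arrival site and the first
   idle server. *)
Lemma queue_insert D P q (O : pred (site n)) s k :
  queue D P q O ->
  let t := iter k (@csucc n) s in
  D t -> ~~ O t ->
  (forall i, (i < k)%N -> D (iter i (@csucc n) s) -> O (iter i (@csucc n) s)) ->
  exists q', queue D (fun x => P x + (s == x))%N q' (fun x => O x || (x == t)).
Proof.
move=> h t Dt Ot hk.
(* [a x] counts how often the new customer leaves [x]; [ha] is its conservation law. *)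
pose a x := (\sum_(i < k) (x == iter i (@csucc n) s))%N.
have ha x : (a x + (x == t) = (s == x) + a (succ x))%N.
  have -> : (a x + (x == t) = \sum_(i < k.+1) (x == iter i (@csucc n) s))%N.
    by rewrite big_ord_recr.
  rewrite big_ord_recl [x == _]eq_sym; congr (_ + _)%N; apply: eq_bigr => i _ /=.
  by rewrite -(inj_eq (can_inj (@succK n))) csuccK.
exists (fun x => q x + a x)%N => x; have [e o] := h x; have hx := ha x.
have [xt|xt] := eqVneq x t.
  subst x; move: hx e o; rewrite eqxx Dt (negbTE Ot) /=.
  by case: (q (succ t)) => [|?]; case: (P t) => [|?] //=; lia.
rewrite (negbTE xt) orbF in hx *.
case Ox: (O x) e o => e o.
  by split; [lia|case: (D x) o => //=; lia].
case Dx: (D x) o => o /=; last by split=> //; lia.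
(* An idle server other than [t] must remain idle: the new customer does not pass it, since every
   server before [t] on its path is in use. *)
suff ax : a x = 0%N by move: o; split; lia.
rewrite /a big1 // => i _; apply/eqP; rewrite eqb0; apply/negP => /eqP xi.
by have := hk i (ltn_ord i); rewrite -xi Dx Ox => /(_ isT).
Qed.

(** The list scanned by [place] makes a full turn from [s], so its first free designated site is the
    one at the least number [k] of clockwise steps. *)
Lemma placeE theta v s c :
  (exists2 t, designated theta t & v t == None) ->
  exists k, let t := iter k (@csucc n) s in
  [/\ designated theta t, v t = None,
      forall i, (i < k)%N ->
        designated theta (iter i (@csucc n) s) -> v (iter i (@csucc n) s) &
      place theta v s c = [ffun r => if r == t then Some c else v r]].
Proof.
case=> t0 Dt0 vt0; rewrite /place.
pose f i := iter i (@csucc n) s; pose a t := designated theta t && (v t == None).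
have [k0 k0n k0t] := csucc_reach s t0.
have ex : exists k, a (f k) by exists k0; rewrite /a /f k0t Dt0.
exists (ex_minn ex); case: ex_minnP => k ak kmin /=.
have kn : (k < 2 * n)%N by apply: leq_ltn_trans k0n; apply: kmin; rewrite /a /f k0t Dt0.
have hk i : (i < k)%N -> ~~ a (f i) by move=> ik; apply/negP => /kmin; lia.
have [Dk /eqP vk] := andP ak; split=> //.
  by move=> i /hk; rewrite /a /f => /nandP[/negbTE-> //|]; case: (v _).
have [m ->] : exists m, (2 * n = k + m.+1)%N by exists (2 * n - k.+1)%N; lia.
rewrite -/a iotaD map_cat filter_cat /= -/(f k) -/(a (f k)) ak (_ : filter a _ = [::]) //.
apply/eqP; rewrite -[_ == _]negbK -has_filter; apply/hasPn => y /mapP[i].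
by rewrite mem_iota /= add0n => /hk ai ->.
Qed.

Definition occupied v : nat := #|[pred x | v x]|.

Lemma card_designated theta : #|[pred x | designated theta x]| = n.
Proof.
rewrite -[RHS]card_ord -(card_image (f := fun i => (i, theta i)) _); last first.
  by move=> i i' [].
apply: eq_card => -[i b]; rewrite !inE /designated /=; apply/eqP/imageP.
  by move=> ->; exists i.
by case=> j _ [-> ->].
Qed.

(* Invariant of the placing process after the particles of [l]. *)
Definition placed theta l v :=
  [/\ forall x, v x -> designated theta x,
      forall c, exists q, queue (designated theta)
        (fun x => count (fun p => (p.1 == x) && (p.2 <= c)%N) l) q (lev c v),
      forall c, count_class v c = count (fun p => p.2 == c) l &
      occupied v = size l].

(** Thresholds below the class of [p] do not see it. At the others every occupied site already
    counts as a used server, so the first unoccupied designated site is the first idle server and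
    [queue_insert] applies. *)
Lemma placed_rcons theta l v p :
  placed theta l v -> all (fun p' => p'.2 <= p.2)%N l -> (size l < n)%N ->
  placed theta (rcons l p) (place theta v p.1 p.2).
Proof.
case: p => s c [hd hq hc ho] /= /allP hl ln.
have [|k /= [Dt vt hk ->]] := placeE (theta := theta) (v := v) s c.
  (* Fewer than [n] sites are occupied and [n] are designated, so a designated site is free. *)
  have : ~~ ([pred x | designated theta x] \subset [pred x | v x : bool]).
    by apply/negP => /subset_leq_card; rewrite card_designated -/(occupied v) ho leqNgt ln.
  by move=> /subsetPn[t]; rewrite !inE => Dt vt; exists t => //; case: (v t) vt.
set t := iter k _ s in Dt vt hk *.
have vle x c' : v x = Some c' -> (c' <= c)%N.
  move=> vx; have : (0 < count_class v c')%N.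
    by apply/card_gt0P; exists x; rewrite inE vx.
  by rewrite hc -has_count => /hasP[p pl /eqP <-]; apply: hl.
split.
- by move=> x; rewrite ffunE; case: eqP => [->|_ /hd].
- move=> c'; have [q hq'] := hq c'.
  have [cc'|cc'] := leqP c c'; last first.
    exists q; apply: queue_ext hq' => // x.
      by rewrite -cats1 count_cat /= leqNgt cc' andbF !addn0.
    rewrite /lev ffunE; case: eqP => [->|//].
    by rewrite vt leqNgt cc'.
  have [||q' hq''] := queue_insert (s := s) (k := k) hq' Dt.
  + by rewrite /lev -/t vt.
  + move=> i ik Di; rewrite /lev; have := hk i ik Di; case E: (v _) => [c''|] // _.
    by rewrite (leq_trans (vle _ _ E)).
  exists q'; apply: queue_ext hq'' => // x.
    by rewrite -cats1 count_cat /= cc' andbT addn0.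
  rewrite /lev ffunE -/t; case: eqP => [->|_]; first by rewrite orbT cc'.
  by rewrite orbF.
- move=> c'; rewrite -cats1 count_cat -hc /= addn0 /count_class.
  rewrite (cardD1 t) [in RHS](cardD1 t) !inE ffunE eqxx vt /= addnC; congr (_ + _)%N.
  by apply: eq_card => x; rewrite !inE ffunE; case: eqP.
rewrite size_rcons -ho /occupied (cardD1 t) [in RHS](cardD1 t) !inE ffunE eqxx vt /= add0n add1n.
by congr S; apply: eq_card => x; rewrite !inE ffunE; case: eqP.
Qed.

Definition class_order u :=
  flatten [seq [seq (s, c) | s <- enum (site n) & u s == Some c] | c <- enum 'I_n.+1].

Lemma placed_foldl theta l :
  pairwise (fun p p' => p.2 <= p'.2)%N l -> (size l <= n)%N ->
  placed theta l (foldl (fun v p => place theta v p.1 p.2) [ffun => None] l).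
Proof.
elim/last_ind: l => [|l p IH].
  move=> _ _; split.
  - by move=> x; rewrite ffunE.
  - by move=> c; exists (fun=> 0%N) => x; rewrite /lev ffunE andbF.
  - by move=> c; apply: eq_card0 => x; rewrite inE ffunE.
  - by apply: eq_card0 => x; rewrite inE ffunE.
rewrite pairwise_rcons size_rcons foldl_rcons => /andP[hl hp] ln.
by apply: placed_rcons => //; apply: IH => //; apply: ltnW.
Qed.

Lemma class_order_sorted u : pairwise (fun p p' => p.2 <= p'.2)%N (class_order u).
Proof.
have : pairwise (fun c c' : 'I_n.+1 => c <= c')%N (enum 'I_n.+1).
  by rewrite -pairwise_map val_enum_ord -sorted_pairwise ?iota_sorted //; apply: leq_trans.
rewrite /class_order; elim: (enum _) => //= c cs IH /andP[/allP hc /IH hcs].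
rewrite pairwise_cat; apply/and3P; split=> //.
  apply/allrelP => p p' /mapP[s _ ->] /flatten_mapP[c' /hc cc' /mapP[s' _ ->]].
  exact: cc'.
elim: (filter _ _) => //= s ss ->; rewrite andbT.
by apply/allP => p /mapP[s' _ ->] /=.
Qed.

Lemma count_class_order u (a : pred (site n * 'I_n.+1)) :
  count a (class_order u) = (\sum_s if u s is Some c then a (s, c) : nat else 0)%N.
Proof.
rewrite count_flatten -map_comp sumnE big_map big_enum /=.
under eq_bigr => c _.
  rewrite count_map count_filter -sum1_count big_enum_cond /= big_mkcond /=.
  over.
rewrite exchange_big /=; apply: eq_bigr => s _.
case: (u s) => [c|]; last by rewrite big1 // => c _; rewrite andbF.
rewrite (bigD1 c) //= eqxx andbT big1 ?addn0; first by case: (a _).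
move=> c' /negbTE cc'; rewrite ifF //; apply/negP => /andP[_ /eqP[/esym/eqP]].
by rewrite cc'.
Qed.

Definition columns u := [forall j : 'I_n, ~~ (u (j, true) && u (j, false))].

Lemma occupied_columns u : columns u -> (occupied u <= n)%N.
Proof.
move=> /forallP h; rewrite -[n in (_ <= n)%N]card_ord /occupied.
rewrite -(card_in_image (f := fst)) ?max_card //.
move=> [i a] [j b]; rewrite !inE /= => ui uj ij; move: uj; rewrite -{j}ij => uj.
by have := h i; move: ui uj; case: a; case: b => // -> ->.
Qed.

Lemma tau_placed theta u : columns u ->
  exists2 v, placed theta (class_order u) v &
  tau theta u = [ffun t => if designated theta t && (v t == None)
    then Some (inord (\max_(s : site n) (if u s is Some c then val c else 0)).+1) else v t].
Proof.
move=> hu; eexists; last by reflexivity.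
apply: placed_foldl; first exact: class_order_sorted.
rewrite -(count_predT) count_class_order; apply: leq_trans (occupied_columns hu).
rewrite /occupied -sum1_card [leqRHS]big_mkcond; apply: leq_sum.
by move=> s _; rewrite !inE; case: (u s).
Qed.

(** The filling class [K] exceeds all classes of [u]: it is invisible at thresholds below [K], and
    completes the occupied sites to all designated sites at the others. *)
Lemma tauP theta u K : columns u -> (0 < K <= n)%N ->
  ((\max_(s : site n) (if u s is Some c then val c else 0)).+1 = K)%N ->
  [/\ tau_rel (designated theta) K u (tau theta u),
      columns (tau theta u),
      occupied (tau theta u) = n &
      forall c, c <> K :> nat -> count_class (tau theta u) c = count_class u c].
Proof.
move=> hu /andP[K0 Kn] hK.
have uK s c : u s = Some c -> (c < K)%N.
  move=> us; rewrite -hK ltnS.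
  by have := leq_bigmax (F := fun s => if u s is Some c then val c else 0) s; rewrite us.
have [v [hd hq hc ho] ->] := tau_placed theta hu; rewrite hK.
have hcu c : count_class v c = count_class u c.
  rewrite hc count_class_order /count_class -sum1_card [RHS]big_mkcond.
  by apply: eq_bigr => s _; rewrite inE; case: (u s).
have vK s c : v s = Some c -> (c < K)%N.
  move=> vs; have : (0 < count_class v c)%N by apply/card_gt0P; exists s; rewrite inE vs.
  by rewrite hcu => /card_gt0P[s']; rewrite inE => /eqP /uK.
(* [K <= n] keeps [inord] away from its default value. *)
have iK : nat_of_ord (inord K : 'I_n.+1) = K by rewrite inordK.
split.
- move=> c; case: ltnP => cK.
    have [q hq'] := hq c; exists q; apply: queue_ext hq' => // x.
      rewrite count_class_order (bigD1 x) //= big1 => [|y /negbTE yx].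
        by rewrite eqxx addn0 /lev; case: (u x).
      by case: (u y) => // c'; rewrite yx.
    rewrite /lev ffunE; case Ev: (v x) => [c'|]; first by rewrite andbF.
    by rewrite eqxx andbT; case: ifP => // _; rewrite iK leqNgt cK.
  move=> x; rewrite /lev ffunE; case Ev: (v x) => [c'|].
    by rewrite andbF hd ?Ev //; apply: leq_trans cK; apply/ltnW/(vK x).
  by rewrite eqxx andbT; case: ifP => // _; rewrite iK.
- apply/forallP => i; rewrite !ffunE.
  have := hd (i, true); have := hd (i, false).
  rewrite /designated /=; case: (theta i) => /= h1 h2.
    by case: (v (i, false)) h1 => [c /(_ isT)|] //=; rewrite andbF.
  by case: (v (i, true)) h2 => [c /(_ isT)|].
- rewrite -[RHS](card_designated theta); apply: eq_card => x; rewrite !inE ffunE.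
  by have := hd x; case: (v x) => [c /(_ isT) ->|_]; rewrite ?andbF // andbT; case: (designated _ _).
move=> c cK; rewrite -hcu; apply: eq_card => x; rewrite !inE ffunE.
case: ifP => // /andP[_ /eqP->]; apply/eqP => -[] /(congr1 val) /=; rewrite iK => /esym.
exact: cK.
Qed.

End Process.

(** * Particle counts and the spaces Omega *)

Section Types.
Set Implicit Arguments. Unset Strict Implicit. Unset Printing Implicit Defensive.
Variable n : nat.
Implicit Types (theta : {ffun 'I_n -> bool}) (u v w x : state n) (s t : site n).
Implicit Types (c : 'I_n.+1) (J : pred nat).

Lemma OmegaP J x :
  reflect (columns x /\ forall c, count_class x c = mJ n J c) (x \in Omega n J).
Proof.
rewrite inE; apply: (iffP andP) => -[hx hc]; split=> //.
  by move=> c; apply/eqP/(forallP hc).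
by apply/forallP => c; apply/eqP.
Qed.

(** A bell does nothing or exchanges the contents of [s] and [succ s], empty or not. *)
Lemma count_class_bell s x c : count_class (bell s x) c = count_class x c.
Proof.
have swap (y : state n) : (forall t, y t = x (tperm s (succ s) t)) ->
    count_class y c = count_class x c.
  move=> hy; rewrite /count_class -!sum1_card [RHS](reindex_inj (@perm_inj _ (tperm s (succ s)))).
  by apply: eq_bigl => t; rewrite !inE hy.
have ss := succ_neq s; rewrite /bell.
case Es: (x s) => [p|] //; case Es': (x (succ s)) => [p'|]; first case: ifP => // _.
all: apply: swap => t; rewrite ffunE; case: tpermP => [->|->|/eqP/negbTE-> /eqP/negbTE->] //.
all: by rewrite ?ss ?eqxx.
Qed.

Lemma columns_lev x :
  columns x = [forall i : 'I_n, ~~ (lev ord_max x (i, true) && lev ord_max x (i, false))].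
Proof. by apply: eq_forallb => i; rewrite !lev_max. Qed.

(** Between the two bells of an interior [sigma j] a column may hold two particles, so both are
    treated together, at the threshold [ord_max] that sees only occupation. *)
Lemma columns_sigma j x : (0 < n)%N -> (j <= n)%N -> columns x -> columns (sigma j x).
Proof.
move=> n0 jn; rewrite !columns_lev => /forallP h; apply/forallP; move: j jn.
apply: sigma_ind => // [k k0|k kn|k l kl] i.
- rewrite (sigma0E _ k0) !lev_bell.
  have [->|ik] := eqVneq i k.
    by rewrite hop_src -(succU0 k0) hop_dst succU0 //; have := h k; do 2!case: (lev _ _ _).
  by rewrite !hop_off ?succU0 ?xpair_eqE ?(negbTE ik) ?andbF.
- rewrite (sigmanE _ kn) !lev_bell.
  have [->|ik] := eqVneq i k.
    by rewrite hop_src -(succLn kn) hop_dst succLn //; have := h k; do 2!case: (lev _ _ _).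
  by rewrite !hop_off ?succLn ?xpair_eqE ?(negbTE ik) ?andbF.
rewrite (sigmaE _ kl); set y := bell (l, true) x.
have yU a : lev ord_max y (a, true) = hop (l, true) (lev ord_max x) (a, true).
  exact: lev_bell.
have yL a : lev ord_max y (a, false) = lev ord_max x (a, false).
  by rewrite lev_bell hop_off ?succU ?(succU kl) ?xpair_eqE ?andbF.
have su := succU kl; have sl := succL kl; rewrite !lev_bell.
have -> : hop (k, false) (lev ord_max y) (i, true) = hop (l, true) (lev ord_max x) (i, true).
  by rewrite hop_off ?sl ?xpair_eqE ?andbF.
have hk := h k; have hl := h l; have hi := h i.
have [->|il] := eqVneq i l.
  rewrite hop_src su -sl hop_dst sl !yL.
  by move: hk hl; do 4!case: (lev _ _ _).
have [->|ik] := eqVneq i k.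
  rewrite hop_src sl -su hop_dst su !yL.
  by move: hk hl; do 4!case: (lev _ _ _).
by rewrite !hop_off ?su ?sl ?xpair_eqE ?(negbTE il) ?(negbTE ik) ?andbF // yL.
Qed.

Lemma count_class_sigma j x c : count_class (sigma j x) c = count_class x c.
Proof.
have ba k b y : count_class (bell_at k b y) c = count_class y c.
  by rewrite /bell_at; case: insub => // i; apply: count_class_bell.
by rewrite /sigma; case: ifP => _; [|case: ifP => _]; rewrite !ba.
Qed.

Lemma sigma_Omega J j x : (0 < n)%N -> (j <= n)%N -> x \in Omega n J ->
  sigma j x \in Omega n J.
Proof.
move=> n0 jn /OmegaP[hx hc]; apply/OmegaP; split; first exact: columns_sigma.
by move=> c; rewrite count_class_sigma.
Qed.

Lemma sum_count_class x : (\sum_c count_class x c)%N = occupied x.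
Proof.
rewrite /occupied -sum1_card [RHS]big_mkcond /=.
under eq_bigr => c _ do rewrite /count_class -sum1_card big_mkcond /=.
rewrite exchange_big /=; apply: eq_bigr => s _; rewrite inE.
case E: (x s) => [c|] /=; last by rewrite big1 // => c _; rewrite inE E.
rewrite (bigD1 c) //= inE E eqxx big1 // => c' /negbTE cc'; rewrite inE E ifF //.
by apply/eqP => -[/esym/eqP]; rewrite cc'.
Qed.

Lemma cls1 J : cls J 1 = 1%N. Proof. by []. Qed.

Lemma clsS J i : cls J i.+2 = (cls J i.+1 + ~~ J i.+1)%N.
Proof.
have := iotaD 1 i 1; rewrite addn1 add1n => e.
rewrite /cls -[i.+2.-1]/(i.+1) e count_cat /= addn0.
by have := count_size J (iota 1 i); rewrite size_iota; case: (J _) => /=; lia.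
Qed.

Lemma cls_le J i k : (0 < i <= k)%N -> (0 < cls J i <= cls J k)%N.
Proof.
case/andP; case: i => // i _; elim: k => // k IH; rewrite ltnS leq_eqVlt => /orP[/eqP<-|].
  rewrite leqnn andbT; elim: i {IH} => // i IH; rewrite clsS; lia.
by case: k IH => // k IH /IH; rewrite clsS; lia.
Qed.

Lemma cls_bound J i : (cls J i <= i)%N. Proof. exact: leq_subr. Qed.

(** [cls J] starts at 1 and grows by steps of at most 1. *)
Lemma cls_onto J k m : (0 < m <= cls J k)%N -> (0 < k)%N ->
  exists2 i, (0 < i <= k)%N & cls J i = m.
Proof.
move=> hm; elim: k hm => // -[|k] IH hm _.
  by exists 1%N; rewrite // cls1; move: hm; rewrite cls1; lia.
have [hmk|hmk] := leqP m (cls J k.+1).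
  have [||i hi <-] := IH; rewrite ?hmk ?andbT //; first by case/andP: hm.
  by exists i => //; lia.
by exists k.+2; rewrite ?leqnn //; move: hm hmk; rewrite clsS; case: (J _) => /=; lia.
Qed.

(** * Adding [n] to [J], the intertwining relation and stationarity *)

Section AddN.
Variable J : pred nat.
Hypothesis n0 : (0 < n)%N.
Hypothesis hJ : forall j, J j -> (0 < j < n)%N.

Lemma cls_extJ i : (i <= n)%N -> cls (extJ n J) i = cls J i.
Proof.
move=> hi; congr (_ - _)%N; apply: eq_in_count => k; rewrite mem_iota /extJ => hk.
by rewrite (_ : (k == n) = false) ?orbF //; lia.
Qed.

Lemma mJE m : mJ n J m = count (fun i => cls J i == m) (iota 1 n).
Proof.
apply: eq_count => i; rewrite (_ : J n = false) ?andbT //.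
by apply/negP => /hJ; rewrite ltnn andbF.
Qed.

(** [cls] at [i <= n] counts only identifications strictly below [i], so adding [n] keeps the
    numbering and just deletes the top class [cls J n]. *)
Lemma mJ_extJ m : mJ n (extJ n J) m = if m == cls J n then 0 else mJ n J m.
Proof.
rewrite mJE /mJ {2}/extJ eqxx orbT /=.
rewrite (eq_in_count (a2 := fun i => (cls J i == m) && (m != cls J n))).
  case: ifP => h; last by apply: eq_count => i; rewrite andbT.
  by apply: etrans (count_pred0 (iota 1 n)); apply: eq_count => i; rewrite andbF.
move=> i; rewrite mem_iota => hi; rewrite !cls_extJ //; last by lia.
by case: eqP => //= ->.
Qed.

Lemma sum_mJ : (\sum_(c < n.+1) mJ n J c = n)%N.
Proof.
under eq_bigr => c _ do rewrite mJE -sum1_count big_mkcond /=.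
rewrite exchange_big /= -[RHS](size_iota 1 n) -sum1_size; apply: eq_big_seq => i.
rewrite mem_iota => hi.
have hc : (cls J i < n.+1)%N by have := cls_bound J i; lia.
rewrite (bigD1 (Ordinal hc)) //= eqxx big1 // => c hcc; rewrite ifF //.
by apply/negP => /eqP e; case/eqP: hcc; apply/val_inj.
Qed.

Lemma max_class u : u \in Omega n (extJ n J) ->
  ((\max_(s : site n) (if u s is Some c then val c else 0)).+1 = cls J n)%N.
Proof.
move=> /OmegaP[_ hu].
have Kn := cls_bound J n.
have K0 : (0 < cls J n)%N by have := @cls_le J n n; rewrite n0 leqnn => /(_ isT)/andP[].
apply/eqP; rewrite eqn_leq; apply/andP; split.
  rewrite -[X in (_ < X)%N](prednK K0) ltnS; apply/bigmax_leqP => s _.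
  case us: (u s) => [c|] //.
  have : (0 < mJ n (extJ n J) c)%N.
    by rewrite -hu; apply/card_gt0P; exists s; rewrite inE us.
  rewrite mJ_extJ; case: eqP => // cK; rewrite mJE -has_count => /hasP[i].
  rewrite mem_iota => hi /eqP ic; have := @cls_le J i n; rewrite ic /=.
  by move: cK => /=; lia.
(* If the top class is 1, the value 0 of the maximum for empty sites suffices. *)
have [->//|K1] := eqVneq (cls J n) 1%N.
have [||i hi ic] := @cls_onto J n (cls J n).-1 => //; first by lia.
have cn : ((cls J n).-1 < n.+1)%N by lia.
pose c : 'I_n.+1 := Ordinal cn.
have : (0 < count_class u c)%N.
  rewrite hu mJ_extJ ifF /=; last by lia.
  rewrite mJE -has_count; apply/hasP; exists i; rewrite ?ic // mem_iota; lia.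
case/card_gt0P => s; rewrite inE => /eqP us.
have := leq_bigmax (F := fun s => if u s is Some c then val c else 0) s.
rewrite us /=; lia.
Qed.

(** All counts except that of the new class are inherited from [u]; the last one follows because
    both totals are [n]. *)
Lemma tau_Omega theta u : u \in Omega n (extJ n J) ->
  tau_rel (designated theta) (cls J n) u (tau theta u) /\ tau theta u \in Omega n J.
Proof.
move=> hu; have [hcol hcnt] := OmegaP _ _ hu.
have Kn := cls_bound J n.
have K0n : (0 < cls J n <= n)%N.
  by have := @cls_le J n n; rewrite n0 leqnn => /(_ isT)/andP[->].
have [h1 h2 h3 h4] := tauP theta hcol K0n (max_class hu).
split=> //; apply/OmegaP; split=> //.
have hne c : c <> cls J n :> nat -> count_class (tau theta u) c = mJ n J c.
  by move=> cK; rewrite h4 // hcnt mJ_extJ; case: eqP.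
move=> c; have [cK|] := eqVneq (nat_of_ord c) (cls J n); last by move/eqP; apply: hne.
have := etrans (etrans (sum_count_class (tau theta u)) h3) (esym sum_mJ).
rewrite (bigD1 c) //= [in RHS](bigD1 c) //=.
rewrite (eq_bigr (fun c : 'I_n.+1 => mJ n J c)); first by move/addIn.
move=> c' cc'; apply: hne => c'K; case/eqP: cc'; apply/val_inj.
by rewrite /= c'K cK.
Qed.

Lemma UcntE v u : Ucnt v u = (\sum_theta (tau theta u == v))%N.
Proof. by rewrite /Ucnt cardsE -sum1_card big_mkcond. Qed.

Lemma Ucnt_sigma v u j : u \in Omega n (extJ n J) -> (j <= n)%N ->
  (Ucnt v (sigma j u) + \sum_theta movable j (flip j theta) * (tau theta u == v)
   = \sum_theta (sigma j (tau theta u) == v)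
     + \sum_theta movable j theta * (tau theta u == v))%N.
Proof.
move=> hu jn; rewrite UcntE.
pose A theta : nat := tau theta (sigma j u) == v.
have flip_sum : (\sum_theta movable j theta * A (flip j theta)
    = \sum_theta movable j (flip j theta) * A theta)%N.
  rewrite (reindex_inj (inv_inj (@flipK n j))); apply: eq_bigr => theta _.
  by rewrite flipK.
(* With this sum added on both sides, and reindexed by [flip j] on the right, the identity holds for
   each [theta] separately. *)
apply: (@addIn (\sum_theta movable j theta * A (flip j theta))%N).
rewrite {2}flip_sum -!big_split /=; apply: eq_bigr => theta _.
have [ht _] := tau_Omega theta hu.
have su : sigma j u \in Omega n (extJ n J) by apply: sigma_Omega.
have [hts _] := tau_Omega theta su.
have [htf _] := tau_Omega (flip j theta) su.
have [hm hd hz] := sigma_tau_rel n0 jn ht.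
have tm : movable j theta ->
    tau theta (sigma j u) = tau theta u /\ tau (flip j theta) (sigma j u) = sigma j (tau theta u).
  by case/hm => h1 h2; split; [apply: tau_rel_uniq hts h1|apply: tau_rel_uniq htf h2].
rewrite -/(A theta).
case m: (movable j theta) tm hz => tm hz; rewrite /A.
  have [e1 e2] := tm isT; rewrite e1 e2; case d: (movable j (flip j theta)); last by lia.
  by rewrite hd //; lia.
case d: (movable j (flip j theta)) hz => hz; first by rewrite hd //; lia.
have e : tau theta (sigma j u) = sigma j (tau theta u).
  by apply: tau_rel_uniq hts _; apply: hz.
by rewrite e; lia.
Qed.

(** The factor [tau theta u == v] does not depend on [j], so the correction sums of [Ucnt_sigma]
    cancel by [movable_balance]. *)
Lemma Ucnt_rate v u : u \in Omega n (extJ n J) ->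
  (\sum_(j < n.+1) rate n j * Ucnt v (sigma j u)
   = \sum_theta \sum_(j < n.+1) rate n j * (sigma j (tau theta u) == v))%N.
Proof.
move=> hu.
have swap (F : nat -> {ffun 'I_n -> bool} -> nat) :
    (\sum_(j < n.+1) rate n j * \sum_theta F j theta
     = \sum_theta \sum_(j < n.+1) rate n j * F j theta)%N.
  rewrite exchange_big /=; apply: eq_bigr => j _; exact: big_distrr.
have bal : (\sum_(j < n.+1) rate n j * \sum_theta movable j (flip j theta) * (tau theta u == v)
    = \sum_(j < n.+1) rate n j * \sum_theta movable j theta * (tau theta u == v))%N.
  rewrite (swap (fun j theta => movable j (flip j theta) * _)%N).
  rewrite (swap (fun j theta => movable j theta * _)%N).
  apply: eq_bigr => theta _.
  under eq_bigr do rewrite mulnA.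
  under [RHS]eq_bigr do rewrite mulnA.
  by rewrite -!big_distrl /= movable_balance.
apply: (@addIn (\sum_(j < n.+1) rate n j *
  \sum_theta movable j (flip j theta) * (tau theta u == v))%N).
rewrite {2}bal -(swap (fun j theta => sigma j (tau theta u) == v : nat)) -!big_split /=.
by apply: eq_bigr => j _; rewrite -!mulnDr Ucnt_sigma // -ltnS.
Qed.

(** Used with [f = Ucnt v] for the intertwining relation and with [f = 1] for the column sums. *)
Lemma sum_M (I : pred nat) (f : state n -> nat) u : u \in Omega n I ->
  (\sum_(w in Omega n I) f w * M I w u = \sum_(j < n.+1) rate n j * f (sigma j u))%N.
Proof.
move=> hu.
under eq_bigr => w hw do rewrite /M hw hu /= big_distrr /=.
rewrite exchange_big /=; apply: eq_bigr => j _.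
have hs : sigma j u \in Omega n I by apply: sigma_Omega; rewrite // -ltnS.
rewrite (bigD1 (sigma j u)) //= eqxx muln1 mulnC big1 ?addn0 // => w /andP[_ /negbTE h].
by rewrite eq_sym h !muln0.
Qed.

Lemma Ucnt_notin v u : u \in Omega n (extJ n J) -> v \notin Omega n J -> Ucnt v u = 0%N.
Proof.
move=> hu hv; rewrite UcntE big1 // => theta _; apply/eqP; rewrite eqb0.
by apply: contraNneq hv => <-; case: (tau_Omega theta hu).
Qed.

Lemma intertwining v u : v \in Omega n J -> u \in Omega n (extJ n J) ->
  (\sum_(w in Omega n (extJ n J)) Ucnt v w * M (extJ n J) w u
   = \sum_(w in Omega n J) M J v w * Ucnt w u)%N.
Proof.
move=> hv hu; rewrite (sum_M (Ucnt v)) // Ucnt_rate //.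
under [RHS]eq_bigr do rewrite UcntE big_distrr /=.
rewrite [RHS]exchange_big /=; apply: eq_bigr => theta _.
have [_ ht] := tau_Omega theta hu.
rewrite (bigD1 (tau theta u)) //= eqxx muln1 [X in (_ + X)%N]big1.
  by rewrite /M hv ht addn0.
by move=> w /andP[_ /negbTE h]; rewrite eq_sym h muln0.
Qed.

(** Self-loops included, the column sums of [M] are one constant for all states and all types, so
    the right-hand sides of the two balance equations carry the same factor. *)
Lemma sum_M1 (I : pred nat) u : u \in Omega n I ->
  (\sum_(w in Omega n I) M I w u = \sum_(j < n.+1) rate n j)%N.
Proof.
move=> hu; have := sum_M (fun=> 1%N) hu.
by under eq_bigr do rewrite mul1n; under [in RHS]eq_bigr do rewrite muln1.
Qed.

Lemma sum_Ucnt u : (\sum_v Ucnt v u)%N = (2 ^ n)%N.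
Proof.
under eq_bigr do rewrite UcntE.
rewrite exchange_big /= -[n in (2 ^ n)%N]card_ord -card_bool -card_ffun -sum1_card.
apply: eq_bigr => theta _; rewrite (bigD1 (tau theta u)) //= eqxx big1 //.
by move=> w /negbTE h; rewrite eq_sym h.
Qed.

Lemma stationary_image (R : realFieldType) (p : state n -> R) :
  is_stationary (extJ n J) p ->
  is_stationary J (fun v => \sum_(u in Omega n (extJ n J)) p u * (Ucnt v u)%:R / 2 ^+ n)%R.
Proof.
case=> p0 pout p1 pbal; split.
- move=> v; apply: sumr_ge0 => u _.
  by rewrite divr_ge0 ?mulr_ge0 ?exprn_ge0 ?ler0n.
- by move=> v hv; rewrite big1 // => u hu; rewrite (Ucnt_notin hu hv) mulr0 mul0r.
- rewrite exchange_big /= -[RHS]p1 [RHS](bigID (mem (Omega n (extJ n J)))) /=.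
  rewrite [X in (_ + X)%R]big1 ?addr0 => [|u /pout //].
  apply: eq_bigr => u _; rewrite -mulr_suml -mulr_sumr -natr_sum sum_Ucnt natrX mulfK //.
  by rewrite expf_neq0 // pnatr_eq0.
move=> v hv.
rewrite -natr_sum sum_M1 // mulr_sumr.
under eq_bigr do rewrite mulr_sumr.
rewrite exchange_big /=.
transitivity (\sum_(u in Omega n (extJ n J))
    p u * (\sum_(w in Omega n J) M J v w * Ucnt w u)%:R / 2 ^+ n)%R.
  apply: eq_bigr => u _; rewrite natr_sum mulr_sumr mulr_suml.
  by apply: eq_bigr => w _; rewrite natrM; ring.
(* The intertwining relation transfers the transition to [extJ n J], where the balance equation of
   [p] applies. *)
transitivity (\sum_(w in Omega n (extJ n J)) (Ucnt v w)%:R / 2 ^+ n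
    * \sum_(u in Omega n (extJ n J)) (M (extJ n J) w u)%:R * p u)%R.
  under [RHS]eq_bigr do rewrite mulr_sumr.
  rewrite [RHS]exchange_big /=; apply: eq_bigr => u hu.
  rewrite -intertwining // natr_sum mulr_sumr mulr_suml.
  by apply: eq_bigr => w _; rewrite natrM; ring.
apply: eq_bigr => w hw; rewrite pbal // -natr_sum sum_M1 //; ring.
Qed.

End AddN.
End Types.

Theorem theorem1 (R : realFieldType) (n : nat) (J : pred nat) :
  (2 <= n)%N ->
  (forall j, J j -> (0 < j < n)%N) ->
  (forall v u, v \in Omega n J -> u \in Omega n (extJ n J) ->
     (\sum_(w in Omega n (extJ n J)) Ucnt v w * M (extJ n J) w u
      = \sum_(w in Omega n J) M J v w * Ucnt w u)%N)
  /\
  (forall (piJ' piJ : state n -> R),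
     is_stationary (extJ n J) piJ' ->
     is_stationary J piJ ->
     (forall p, is_stationary J p -> p = piJ) ->
     (fun v => (\sum_(u in Omega n (extJ n J))
                  piJ' u * (Ucnt v u)%:R / 2 ^+ n)%R) = piJ).
Proof.
move=> n2 hJ; have n0 : (0 < n)%N by apply: leq_trans n2.
split=> [v u hv hu|p q hp _]; first exact: intertwining.
by apply; apply: stationary_image.
Qed.
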